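(* Let $G=(V,E)$ be a finite graph and $\overline G$ its complement graph. Then $\mathrm{c\text{-}rk}\,\overline G$ equals the height of the lattice $\widetilde{\overline{\mathcal S}_V}=\{\bigcup\mathcal T\mid \mathcal T\subseteq\{\overline{\mathrm{St}}(v)\mid v\in V\}\}$ ordered by inclusion.
   Context: Graphs are finite, undirected, without loops or multiple edges. The complement $\overline G=(V,\overline E)$ has $\{v,w\}\in\overline E$ iff $v\neq w$ and $\{v,w\}\notin E$. $\mathrm{St}(v)$ is the set of neighbours of $v$ in $G$, and $\overline{\mathrm{St}}(v)=\mathrm{St}(v)\cup\{v\}$ is its closed star; the union of the empty family is $\emptyset$. The height of a finite poset is the maximum $k$ such that it has a chain $p_0<\dots<p_k$. For a graph $H=(U,F)$, $\mathrm{c\text{-}rk}\,H$ is the maximum number of independent columns of the $U\times U$ boolean matrix $A^c_H$ (entry $0$ if $\{i,j\}\in F$, else $1$), where vectors over the superboolean semiring $\{0,1,1^\nu\}$ (with $0+x=x$, $1+1=1^\nu$, $1^\nu+x=1^\nu$, $0\cdot x=0$, $1\cdot1=1$, $1\cdot1^\nu=1^\nu\cdot1^\nu=1^\nu$) are dependent if some $\{0,1\}$-combination, not all coefficients zero, has all coordinates in $\{0,1^\nu\}$, and independent otherwise. *)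

(* Defs.v *)
From HB Require Import structures.
From mathcomp Require Import all_boot all_order all_algebra.

Set Implicit Arguments.
Unset Strict Implicit.
Unset Printing Implicit Defensive.

Import Order.TTheory GRing.Theory.
Local Open Scope ring_scope.

Record sgraph (V : finType) := SGraph {
  adj :> rel V;
  adj_sym : symmetric adj;
  adj_irr : irreflexive adj
}.

Section Complement.
Variables (V : finType) (G : sgraph V).

Definition compl_adj : rel V := [rel v w | (v != w) && ~~ G v w].

Lemma compl_adj_sym : symmetric compl_adj.
Proof. by move=> v w; rewrite /compl_adj /= eq_sym adj_sym. Qed.

Lemma compl_adj_irr : irreflexive compl_adj.
Proof. by move=> v; rewrite /compl_adj /= eqxx. Qed.

Definition compl : sgraph V := SGraph compl_adj_sym compl_adj_irr.

End Complement.

Definition star (V : finType) (G : sgraph V) (v : V) : {set V} :=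
  [set w | G v w].

Definition closed_star (V : finType) (G : sgraph V) (v : V) : {set V} :=
  v |: star G v.

Definition closed_stars (V : finType) (G : sgraph V) : {set {set V}} :=
  [set closed_star G v | v : V].

Definition unions (V : finType) (S : {set {set V}}) : {set {set V}} :=
  [set (\bigcup_(A in T) A)%SET | T : {set {set V}} in powerset S].

(** A chain with [k + 1] elements, [p_0 < ... < p_k], for the order that the
    subset [P] inherits from [X]. *)
Definition has_chain d (X : finPOrderType d) (P : {set X}) (k : nat) : bool :=
  [exists p : k.+1.-tuple X,
     sorted (fun x y => x < y)%O p && all (fun x => x \in P) p].

(* The range [k < #|P|] loses no chain. *)
Lemma has_chain_lt_card d (X : finPOrderType d) (P : {set X}) (k : nat) :
  has_chain P k -> (k < #|P|)%N.
Proof.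
case/existsP=> p /andP[/lt_sorted_uniq p_uniq /allP pP].
rewrite -[k.+1](size_tuple p) -(card_uniqP p_uniq).
by apply/subset_leq_card/subsetP.
Qed.

Definition height d (X : finPOrderType d) (P : {set X}) : nat :=
  \max_(k < #|P| | has_chain P k) k.

(** [SBnu] is the element 1^nu. *)
Inductive superbool := SB0 | SB1 | SBnu.

Definition sb_to_ord (x : superbool) : 'I_3 :=
  match x with SB0 => inord 0 | SB1 => inord 1 | SBnu => inord 2 end.

Definition sb_of_ord (i : 'I_3) : superbool :=
  match val i with 0%N => SB0 | 1%N => SB1 | _ => SBnu end.

Lemma sb_to_ordK : cancel sb_to_ord sb_of_ord.
Proof. by case; rewrite /sb_of_ord /= inordK. Qed.

HB.instance Definition _ := Finite.copy superbool (can_type sb_to_ordK).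

Definition sb_add (x y : superbool) : superbool :=
  match x, y with
  | SB0, z | z, SB0 => z
  | _, _ => SBnu
  end.

Definition sb_mul (x y : superbool) : superbool :=
  match x, y with
  | SB0, _ | _, SB0 => SB0
  | SB1, SB1 => SB1
  | _, _ => SBnu
  end.

Lemma sb_addA : associative sb_add. Proof. by do 3!case. Qed.
Lemma sb_addC : commutative sb_add. Proof. by do 2!case. Qed.
Lemma sb_add0 : left_id SB0 sb_add. Proof. by case. Qed.

HB.instance Definition _ := GRing.isNmodule.Build superbool
  sb_addA sb_addC sb_add0.

Lemma sb_mulA : associative sb_mul. Proof. by do 3!case. Qed.
Lemma sb_mulC : commutative sb_mul. Proof. by do 2!case. Qed.
Lemma sb_mul1 : left_id SB1 sb_mul. Proof. by case. Qed.
Lemma sb_mulD : left_distributive sb_mul sb_add. Proof. by do 3!case. Qed.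
Lemma sb_mul0 : left_zero SB0 sb_mul. Proof. by case. Qed.
Lemma sb_neq10 : SB1 != SB0.
Proof. by apply/eqP. Qed.

HB.instance Definition _ := GRing.Nmodule_isComNzSemiRing.Build superbool
  sb_mulA sb_mulC sb_mul1 sb_mulD sb_mul0 sb_neq10.

Definition ghost (x : superbool) : bool := (x == 0) || (x == SBnu).

(** A [U x U] superboolean matrix is a function [A : U -> U -> superbool], with
    row index first.  Columns are selected by their index, so two equal columns
    with distinct indices form a family of two vectors (always a dependent one:
    their sum only has coordinates 0 + 0 = 0, 1 + 1 = 1^nu and
    1^nu + 1^nu = 1^nu). *)
Definition cols_dependent (U : finType) (A : U -> U -> superbool)
    (J : {set U}) : bool :=
  [exists c : {ffun U -> bool},
     [exists j in J, c j]
     && [forall i, ghost (\sum_(j in J) (c j)%:R * A i j)]].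

Definition cols_independent (U : finType) (A : U -> U -> superbool)
    (J : {set U}) : bool := ~~ cols_dependent A J.

Definition col_rank (U : finType) (A : U -> U -> superbool) : nat :=
  \max_(J : {set U} | cols_independent A J) #|J|.

Definition cmatrix (U : finType) (H : sgraph U) (i j : U) : superbool :=
  if H i j then 0 else 1.

Definition c_rk (U : finType) (H : sgraph U) : nat := col_rank (cmatrix H).

(* Main.v *)
(** The columns of the matrix of the complement graph are the indicator vectors
    of the closed stars.  A set of 0-1 columns is independent when every nonempty
    subset of it has a row meeting exactly one of its columns.  Removing from an
    independent set the column singled out by such a row strictly decreases the
    union of the columns, so peeling columns one by one gives a chain of unions.
    Conversely, each strict step [X < Y] of a chain of unions yields a closed
    star inside [Y] that contains a vertex outside [X]; the stars chosen in this
    way are independent, because that vertex lies in none of the stars chosen at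
    lower steps. *)
Require Import Defs.
From mathcomp Require Import all_boot all_order all_algebra.
(* {set V} ordered by inclusion *)
Import Order.DefaultSetSubsetOrder.

Set Implicit Arguments.
Unset Strict Implicit.
Unset Printing Implicit Defensive.

Import Order.TTheory GRing.Theory.

Lemma lt_set_proper (T : finType) (X Y : {set T}) : (X < Y)%O = (X \proper Y).
Proof. by rewrite lt_neqAle properEneq. Qed.

(** The images of 0 and 1 are [SB0] and [SB1], and every larger integer collapses to [SBnu]. *)
Lemma ghost_natr (n : nat) : ghost n%:R%R = (n != 1).
Proof.
have nu m : (m.+2%:R)%R = SBnu :> superbool.
  by elim: m => // m IHm; rewrite mulrS IHm.
case: n => [|[|m]]; rewrite /ghost ?nu ?eqxx ?orbT //.
by apply/negbTE/negP; case/orP=> /eqP.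
Qed.

(** Coefficients in {0,1} amount to a subset [K] of [J]; coordinate [i] of the combination is the
    image of the number of columns of [K] with entry 1 in row [i], so it is not a ghost exactly when
    this number is 1. *)
Lemma boolean_cols_independentP (U : finType) (B : rel U) (J : {set U}) :
  reflect (forall K : {set U}, K \subset J -> K != set0 ->
             exists i, #|[set j in K | B i j]| = 1)
          (cols_independent (fun i j => (B i j)%:R%R) J).
Proof.
have sumE (c : pred U) i :
    (\sum_(j in J) (c j)%:R * (B i j)%:R = 
      #|[set j in [set j in J | c j] | B i j]|%:R :> superbool)%R.
  rewrite -sum1_card natr_sum big_mkcond [RHS]big_mkcond.
  apply: eq_bigr => j _; rewrite !inE.
  by case: (j \in J) (c j) (B i j) => [] [] [].
apply: (iffP idP) => [indJ K KJ /set0Pn[j0 Kj0]|indJ].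
  case/existsPn/(_ [ffun j => j \in K])/nandP: indJ => [/existsPn/(_ j0)|].
    by rewrite ffunE Kj0 (subsetP KJ).
  case/forallPn=> i; rewrite sumE ghost_natr negbK => /eqP card1.
  exists i; rewrite -card1; apply: eq_card => j; rewrite !inE ffunE.
  by case: (boolP (j \in K)) => [/(subsetP KJ)->|]; rewrite ?andbF.
apply/existsPn=> c; apply/negP=> /andP[/existsP[j0 Jcj0] /forallP gh].
have [||i card1] := indJ [set j in J | c j].
- by apply/subsetP=> j; rewrite inE => /andP[].
- by apply/set0Pn; exists j0; rewrite inE.
by move: (gh i); rewrite sumE ghost_natr card1.
Qed.

Lemma has_chainP d (X : finPOrderType d) (P : {set X}) (k : nat) :
  reflect (exists s : seq X, [/\ sorted (fun x y => x < y)%O s,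
             {subset s <= P} & size s = k.+1])
          (has_chain P k).
Proof.
apply: (iffP existsP) => [[p /andP[lt_p /allP pP]]|[s [lt_s sP sz_s]]].
  by exists p; rewrite size_tuple.
by exists (tcast sz_s (in_tuple s)); rewrite val_tcast /= lt_s; apply/allP.
Qed.

Lemma height_leP d (X : finPOrderType d) (P : {set X}) (n : nat) :
  reflect (forall k, has_chain P k -> k <= n) (height P <= n).
Proof.
apply: (iffP (bigmax_leqP _ _ _)) => [le_n k ch_k|le_n k]; last exact: le_n.
exact: (le_n (Ordinal (has_chain_lt_card ch_k))).
Qed.

Section UnionsOfFamily.
Variables (U : finType) (f : U -> {set U}).

Let A (i j : U) : superbool := (i \in f j)%:R%R.
Let P : {set {set U}} := unions [set f v | v : U].

Lemma bigcup_in_unions (J : {set U}) : \bigcup_(j in J) f j \in P.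
Proof.
(* [f] may fail to be injective; idempotence of union absorbs the repetitions. *)
apply/imsetP; exists (f @: J); last by rewrite big_imset_idem //; exact: setUid.
by rewrite powersetE; apply/subsetP=> _ /imsetP[j _ ->]; apply: imset_f.
Qed.

Lemma unions_member (X : {set U}) (i : U) :
  X \in P -> i \in X -> exists2 j, i \in f j & f j \subset X.
Proof.
case/imsetP=> T; rewrite powersetE => /subsetP subT -> /bigcupP[Y TY Yi].
have /imsetP[j _ Yj] := subT Y TY; exists j; rewrite -Yj //.
exact: bigcup_sup TY.
Qed.

Lemma cols_independent_chain (J : {set U}) :
  cols_independent A J -> has_chain P #|J|.
Proof.
move/boolean_cols_independentP=> indJ; apply/has_chainP.
(* Prescribing the top of the chain lets the induction append the next union. *)
suff [s [lt_s sP sz_s _]]: exists s : seq {set U},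
    [/\ sorted (fun x y => x < y)%O s, {subset s <= P}, size s = #|J|.+1
      & last set0 s = \bigcup_(j in J) f j] by exists s.
have [n] := ubnP #|J|; elim: n J indJ => // n IHn J indJ ltJn.
have [->|J0] := eqVneq J set0.
  exists [:: set0]; rewrite cards0 big_set0; split=> // X.
  by rewrite inE => /eqP->; have := bigcup_in_unions set0; rewrite big_set0.
(* Among the sets indexed by [J], only [f j] contains [i], so dropping [j] removes [i] from the
   union. *)
have [i /eqP/cards1P[j Ej]] := indJ J (subxx J) J0.
have /setIdP[Jj fji] : j \in [set j in J | i \in f j] by rewrite Ej set11.
have cardJ := cardsD1 j J; rewrite Jj add1n in cardJ.
have [||s [lt_s sP sz_s last_s]] := IHn (J :\ j).
- by move=> K /subset_trans/(_ (subsetDl _ _)); apply: indJ.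
- by rewrite -ltnS -cardJ.
exists (rcons s (\bigcup_(j in J) f j)); split; last 2 first.
- by rewrite size_rcons sz_s cardJ.
- by rewrite last_rcons.
- case: s lt_s sz_s last_s {sP} => // X s /= lt_s _ last_s.
  rewrite rcons_path lt_s last_s /=.
  rewrite lt_set_proper (big_setD1 _ Jj) /=; apply/properP; split.
    exact: subsetUr.
  exists i; first by rewrite inE fji.
  apply/bigcupP=> -[m /setD1P[mj Jm] fmi].
  have: m \in [set j in J | i \in f j] by rewrite inE Jm.
  by rewrite Ej inE (negPf mj).
- by move=> X; rewrite mem_rcons inE => /predU1P[->|/sP//]; apply: bigcup_in_unions.
Qed.

Lemma chain_cols_independent (k : nat) :
  has_chain P k -> exists2 J : {set U}, cols_independent A J & #|J| = k.
Proof.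
case/has_chainP=> s0 []; case: s0 => //= X s lt_s sP [<-].
(* Keeping the chosen sets inside the top of the chain ensures that a point outside that top avoids
   them all. *)
suff [J [indJ szJ _]]: exists J : {set U},
    [/\ cols_independent A J, #|J| = size s
      & {in J, forall j, f j \subset last X s}] by exists J.
elim/last_ind: s lt_s sP => [|s Y IHs] /=.
  exists set0; split; rewrite ?cards0 //; last by move=> j; rewrite inE.
  by apply/boolean_cols_independentP=> K; rewrite subset0 => /eqP->; rewrite eqxx.
rewrite rcons_path => /andP[lt_s]; rewrite lt_set_proper.
case/properP=> lastY [i Yi lasti] sP.
have [||J [indJ szJ subJ]] := IHs => //.
  by move=> Z Zs; apply: sP; rewrite -rcons_cons mem_rcons inE Zs orbT.
have [||j fji fjY] := @unions_member Y i => //.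
  by apply: sP; rewrite -rcons_cons mem_rcons mem_head.
have Jj : j \notin J by apply: contra lasti => /subJ/subsetP; apply.
exists (j |: J); split.
- apply/boolean_cols_independentP=> K KjJ K0.
  (* Without [j], [K] lies in the independent set [J]; with [j], row [i] meets column [j] alone. *)
  have [Kj|Kj] := boolP (j \in K); last first.
    move/boolean_cols_independentP: indJ; apply=> //.
    by rewrite -(setU1K Jj) subsetD1 KjJ.
  exists i; apply/eqP/cards1P; exists j; apply/setP=> m; rewrite !inE.
  have [->|mj] := eqVneq m j; first by rewrite Kj.
  apply: contraNF lasti => /andP[/(subsetP KjJ)].
  by rewrite !inE (negPf mj) => /subJ/subsetP; apply.
- by rewrite cardsU1 Jj szJ size_rcons.
- move=> m; rewrite last_rcons => /setU1P[->//|/subJ/subset_trans]; exact.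
Qed.

Lemma col_rank_eq_height : col_rank A = height P.
Proof.
apply/eqP; rewrite eqn_leq; apply/andP; split.
  apply/bigmax_leqP=> J /cols_independent_chain.
  by have /height_leP/(_ _) := leqnn (height P); apply.
apply/height_leP=> k /chain_cols_independent[J indJ <-].
exact: leq_bigmax_cond.
Qed.

End UnionsOfFamily.

Theorem theorem9p4 (V : finType) (G : sgraph V) :
  c_rk (compl G) = height (unions (closed_stars G)).
Proof.
rewrite -col_rank_eq_height.
(* The complement has no loops, so the diagonal entries are 1, which is why the stars are closed. *)
have E i j : cmatrix (compl G) i j = (i \in closed_star G j)%:R%R.
  rewrite /cmatrix /= /compl_adj /= /closed_star /star !inE (adj_sym G j).
  by case: eqVneq => //= _; case: (G i j).
apply: eq_bigl => J; congr (~~ _); apply: eq_existsb => c; congr (_ && _).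
by apply: eq_forallb => i; under eq_bigr do rewrite E.
Qed.
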